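(* Let $f:\mathbb{Z}_+\to\mathbb{Q}_+\cap(0,1]$ be a non-strictly decreasing function, and write $f(x)=\frac{A(x)}{B(x)}$ with $A(x)\in\mathbb{Z}$, $B(x)\in\mathbb{Z}_+$, $\gcd(A(x),B(x))=1$. Define $$g_f(x)=\frac{(f(x))^2\cdot f\left(\frac{A(x)x^2}{f(x)}+2\right)}{(A(x)x)^2}.$$ Let $\alpha$ be a real number and assume that the inequality $$\left|\alpha-\frac{p}{q}\right|<\frac{f(q)}{q^2}$$ has infinitely many solutions in rationals $\frac{p}{q}$ ($p\in\mathbb{Z}$, $q\in\mathbb{Z}_+$). Then for any $\varepsilon>0$ the stronger inequality $$\left|\alpha-\frac{p}{q}\right|<\frac{f(q)-(1-\varepsilon)g_f(q)}{q^2}$$ also has infinitely many solutions in rationals $\frac{p}{q}$.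
   Context: $\mathbb{Z}_+$ is the set of positive integers, $\mathbb{Q}_+$ the set of positive rationals. Note $\frac{A(x)x^2}{f(x)}+2=B(x)x^2+2$ is a positive integer, so $g_f$ is well defined. *)

(* Defs.v *)
From HB Require Import structures.
From mathcomp Require Import all_boot all_order all_algebra.
From mathcomp Require Import boolp classical_sets cardinality reals.

Set Implicit Arguments.
Unset Strict Implicit.
Unset Printing Implicit Defensive.

Import Order.TTheory GRing.Theory Num.Theory.

Local Open Scope classical_set_scope.
Local Open Scope ring_scope.

(* A function on the positive integers is represented by [f : nat -> rat];
   its value at 0 is never used. In lowest terms, f(x) = A(x) / B(x) with
   A(x) = numq (f x) and B(x) = denq (f x) > 0. *)

(* A(x) x^2 / f(x) + 2, as a natural number: it equals B(x) x^2 + 2, see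
   [gf_argE]. *)
Definition gf_arg (f : nat -> rat) (x : nat) : nat :=
  (`|denq (f x)| * x ^ 2 + 2)%N.

Lemma gf_argE (f : nat -> rat) (x : nat) : 0 < f x ->
  (gf_arg f x)%:R = (numq (f x))%:Q * x%:R ^+ 2 / f x + 2.
Proof.
move=> f_gt0; rewrite /gf_arg natrD natrM natrX; congr (_ + _).
have -> : (`|denq (f x)|%N)%:R = (denq (f x))%:Q.
  by rewrite -[RHS]/((denq (f x))%:~R) -[in RHS]absz_denq.
rewrite numqE mulrAC; congr (_ * _).
by rewrite mulrAC mulfV ?mul1r // gt_eqF.
Qed.

Definition gf (f : nat -> rat) (x : nat) : rat :=
  f x ^+ 2 * f (gf_arg f x) / ((numq (f x))%:Q * x%:R) ^+ 2.

(* The set of rational numbers p/q with |alpha - p/q| < phi(q) / q^2. The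
   fraction p/q need not be in lowest terms, but solutions are counted as
   rational numbers, not as pairs (p, q). *)
Definition approx_solutions (R : realType) (alpha : R) (phi : nat -> R) :
    set rat :=
  [set r : rat | exists (p : int) (q : nat),
    [/\ (0 < q)%N, r = p%:~R / q%:R
      & `|alpha - p%:~R / q%:R| < phi q / q%:R ^+ 2]].

(* Main.v *)
Require Import Defs.
From HB Require Import structures.
From mathcomp Require Import all_boot all_order all_algebra.
From mathcomp Require Import boolp classical_sets cardinality reals.
From mathcomp Require Import ring lra zify.

Import Order.TTheory GRing.Theory Num.Theory.

Local Open Scope classical_set_scope.
Local Open Scope ring_scope.

(** If a solution [p/q] of the weak inequality fails the strong one, then alpha
    lies within [(1 - eps) g_f(q) / q^2] of [p/q + f(q)/q^2] or of
    [p/q - f(q)/q^2], without being equal to it. That point is a fraction [P/Q]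
    with [Q = B(q) q^2], and [g_f] is chosen so that
    [g_f(q) / q^2 = f(Q + 2) / Q^2]. As [f(Q + 2) <= f(Q)] and
    [g_f(Q) <= f(Q) / Q^2], the fraction [P/Q] satisfies the strong inequality
    once [Q] is large. Since [P/Q] tends to alpha but differs from it, this
    yields infinitely many solutions. *)

Section Approximation.
Variable R : realType.
Implicit Types (alpha eps : R) (phi : nat -> R) (f : nat -> rat).

(** Since [phi q <= 1], such a fraction lies within 1 of [alpha], so [|p| < N (|alpha| + 1)] and
    only finitely many pairs [(p, q)] remain. *)
Lemma finite_approx_bounded_denominator alpha phi (N : nat) :
    (forall q, (0 < q)%N -> phi q <= 1) ->
  finite_set [set r : rat | exists (p : int) (q : nat),
    [/\ (0 < q < N)%N, r = p%:~R / q%:R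
      & `|alpha - p%:~R / q%:R| < phi q / q%:R ^+ 2]].
Proof.
move=> phi_le1.
pose M := Num.bound (N%:R * (`|alpha| + 1)).
(* The shift by [M] lets natural indices run through the numerators from [-M] to [M - 1]. The
   entries with [j = 0] do no harm, as only an inclusion is needed. *)
pose s := [seq (i%:R - M%:R) / j%:R : rat | i <- iota 0 (M + M), j <- iota 0 N].
apply: (sub_finite_set (B := [set` s])); last exact: finite_seq.
move=> _ [p [q [/andP[q0 qN] -> pq]]] /=.
have qR : 0 < q%:R :> R by rewrite ltr0n.
have q1 : 1 <= q%:R :> R by rewrite ler1n.
have qN' : q%:R <= N%:R :> R by rewrite ler_nat ltnW.
have dist1 : `|alpha - p%:~R / q%:R| < 1.
  apply: lt_le_trans pq _; rewrite ler_pdivrMr ?exprn_gt0 // mul1r.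
  by apply: le_trans (phi_le1 _ q0) _; rewrite exprn_ege1.
have fracB : `|p%:~R / q%:R : R| < `|alpha| + 1.
  rewrite -[p%:~R / q%:R](subKr alpha).
  by apply: le_lt_trans (ler_normB _ _) _; rewrite ltrD2l.
have pB : `|p%:~R : R| < M%:R.
  rewrite -[p%:~R](@divfK _ q%:R) ?gt_eqF // normrM (gtr0_norm qR).
  apply: lt_trans (archi_boundP _) => //; last by rewrite mulr_ge0 // addr_ge0.
  rewrite mulrC; apply: (@lt_le_trans _ _ (q%:R * (`|alpha| + 1))).
    by rewrite ltr_pM2l.
  by rewrite ler_wpM2r // addr_ge0.
have pM : (`|p| < M%:Z)%R by rewrite -(ltr_int R) intr_norm.
apply/allpairsP; exists (absz (p + M%:Z), q); split.
- by rewrite mem_iota /fst /snd; clearbody M; lia.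
- by rewrite mem_iota /fst /snd; clearbody M; lia.
- congr (_ / _); rewrite -[X in X - _]/((Posz (absz (p + M%:Z)))%:~R).
  by rewrite gez0_abs ?rmorphD /= ?addrK //; lia.
Qed.

Lemma infinite_approx_large_denominator {alpha phi} :
    (forall q, (0 < q)%N -> phi q <= 1) ->
    infinite_set (approx_solutions alpha phi) ->
  forall (S : set rat), finite_set S -> forall N : nat,
  exists (p : int) (q : nat), [/\ (0 < q)%N, (N <= q)%N,
    ~ S (p%:~R / q%:R) & `|alpha - p%:~R / q%:R| < phi q / q%:R ^+ 2].
Proof.
move=> phi_le1 inf S finS N; apply: contrapT => noSol; apply: inf.
have fin := finite_approx_bounded_denominator alpha phi N phi_le1.
apply: sub_finite_set (_ : finite_set (S `|` _)); last first.
  by rewrite finite_setU; split; [exact: finS|exact: fin].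
move=> r [p [q [q0 -> pq]]].
have [Sr|nSr] := pselect (S (p%:~R / q%:R)); first by left.
right; exists p, q; split => //; rewrite q0 /= ltnNge; apply/negP => Nq.
by apply: noSol; exists p, q.
Qed.

(** Take [1/N] below the distance from [alpha] to every element of [S] other than [alpha]. A
    rational [alpha] may itself lie in [S], hence the form of the conclusion. *)
Lemma finite_set_far alpha (S : set rat) : finite_set S ->
  exists N : nat, forall n : nat, (N <= n)%N -> forall r, S r ->
    `|alpha - ratr r| < n%:R^-1 -> ratr r = alpha.
Proof.
move=> /finite_seqP[s ->]; elim: s => [|a s [N IH]].
  by exists 0%N => n _ r; rewrite /= in_nil.
exists (maxn N (Num.bound (`|alpha - ratr a|^-1))) => n.
rewrite geq_max => /andP[Nn an] r; rewrite /= in_cons => /orP[/eqP->|rs]; last first.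
  exact: IH.
have [-> //|neq] := eqVneq (ratr a) alpha.
have d0 : 0 < `|alpha - ratr a| by rewrite normr_gt0 subr_eq0 eq_sym.
have dn : `|alpha - ratr a|^-1 < n%:R.
  apply: (@lt_le_trans _ _ (Num.bound `|alpha - ratr a|^-1)%:R).
    by rewrite archi_boundP // invr_ge0.
  by rewrite ler_nat.
have n0 : 0 < n%:R :> R by apply: lt_trans dn; rewrite invr_gt0.
by rewrite -[X in X < _]invrK ltf_pV2 ?posrE ?invr_gt0 // ltNge (ltW dn).
Qed.

(** Both values of [f] are at most 1, and the numerator of [f x] is at least 1. *)
Lemma gf_le f (x : nat) :
    (forall y, (0 < y)%N -> 0 < f y <= 1) -> (0 < x)%N ->
  0 <= gf f x <= f x / x%:R ^+ 2.
Proof.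
move=> f_range x0; have /andP[fx0 fx1] := f_range _ x0.
have /andP[fa0 fa1] : 0 < f (gf_arg f x) <= 1.
  by apply: f_range; rewrite /gf_arg addn2.
have xR : 0 < x%:R :> rat by rewrite ltr0n.
have A1 : 1 <= (numq (f x))%:Q by rewrite ler1z; have := numq_gt0 (f x); lia.
rewrite /gf; apply/andP; split.
  by rewrite divr_ge0 ?sqr_ge0 // mulr_ge0 ?sqr_ge0 // ltW.
apply: ler_pM; rewrite ?invr_ge0 ?sqr_ge0 //.
- by rewrite mulr_ge0 ?sqr_ge0 // ltW.
- by nra.
- rewrite lef_pV2 ?posrE ?exprn_gt0 ?mulr_gt0 //; last by lra.
  by rewrite exprMn ler_peMl ?sqr_ge0 // exprn_ege1.
Qed.

Lemma gf_div_sqr f (x : nat) : 0 < f x -> (0 < x)%N ->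
  gf f x / x%:R ^+ 2 =
  f (gf_arg f x) / (`|denq (f x)| * x ^ 2)%N%:R ^+ 2.
Proof.
move=> fx0 x0.
have xR : x%:R != 0 :> rat by rewrite pnatr_eq0 -lt0n.
have B0 : (denq (f x))%:Q != 0 by rewrite intr_eq0 denq_eq0.
have -> : (`|denq (f x)| * x ^ 2)%N%:R = (denq (f x))%:Q * x%:R ^+ 2.
  by rewrite natrM natrX -[in RHS]absz_denq.
have f0 : f x != 0 by rewrite gt_eqF.
by rewrite /gf numqE; field; rewrite xR B0 f0.
Qed.

(** [P] comes from the common denominator and need not be coprime to it, which [approx_solutions]
    allows. *)
Lemma frac_shift (p : int) (q : nat) (a : rat) (b : bool) : (0 < q)%N ->
  exists P : int, P%:~R / (`|denq a| * q ^ 2)%N%:R =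
    p%:~R / q%:R + (-1) ^+ b * (ratr a / q%:R ^+ 2) :> R.
Proof.
move=> q0; exists (p * q%:Z * denq a + (-1) ^+ b * numq a).
have qR : q%:R != 0 :> R by rewrite pnatr_eq0 -lt0n.
have B0 : (denq a)%:~R != 0 :> R by rewrite intr_eq0 denq_eq0.
have -> : (`|denq a| * q ^ 2)%N%:R = (denq a)%:~R * q%:R ^+ 2 :> R.
  by rewrite natrM natrX -[in RHS]absz_denq.
rewrite rmorphD !rmorphM /= rmorph_sign /ratr.
by field; rewrite qR B0.
Qed.

End Approximation.

Theorem theorem2 (R : realType) (f : nat -> rat)
    (f_range : forall x : nat, (0 < x)%N -> 0 < f x <= 1)
    (f_decr : forall x y : nat, (0 < x)%N -> (x <= y)%N -> f y <= f x)
    (alpha : R)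
    (f_inf : infinite_set (approx_solutions alpha (fun q => ratr (f q)))) :
  forall eps : R, 0 < eps ->
    infinite_set (approx_solutions alpha
      (fun q => ratr (f q) - (1 - eps) * ratr (gf f q))).
Proof.
move=> eps eps0 finS.
have [N far] := finite_set_far R alpha _ finS.
have f_le1 q : (0 < q)%N -> ratr (f q) <= 1 :> R.
  by move=> /f_range/andP[_]; rewrite -(ler_rat R) rmorph1.
(* The bound [N] serves [far]; the other one gives [1/eps < q <= Q]. *)
have [p [q [q0 Nq nS pq]]] := infinite_approx_large_denominator R f_le1 f_inf
  _ finS (maxn N (Num.bound eps^-1)).
have {nS} pq' : ratr (f q) - (1 - eps) * ratr (gf f q) <=
    `|alpha - p%:~R / q%:R| * q%:R ^+ 2.
  rewrite -ler_pdivrMr ?exprn_gt0 ?ltr0n // leNgt; apply/negP => strong.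
  by apply: nS; exists p, q.
have /andP[fq0 _] := f_range _ q0.
have q2 : 0 < q%:R ^+ 2 :> R by rewrite exprn_gt0 ?ltr0n.
set Q := (`|denq (f q)| * q ^ 2)%N.
have qQ : (q <= Q)%N by rewrite /Q; have := denq_gt0 (f q); nia.
have Q0 : (0 < Q)%N by apply: leq_trans qQ.
have QR : 1 <= Q%:R :> R by rewrite ler1n.
move: (Nq); rewrite geq_max => /andP[Nq1 Nq2].
have epsQ : eps^-1 < Q%:R.
  apply: lt_le_trans (_ : (Num.bound eps^-1)%:R <= _).
    by rewrite archi_boundP // invr_ge0 ltW.
  by rewrite ler_nat (leq_trans Nq2).
(* The sign puts [P/Q] on the same side of [p/q] as [alpha]. Then [alpha] lies between the two
   fractions, and its distances to them add up to [f(q)/q^2]. *)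
pose b := alpha < p%:~R / q%:R.
have [P PQ] := frac_shift R p q (f q) b q0; rewrite -/Q in PQ.
have distE : `|alpha - P%:~R / Q%:R| =
    ratr (f q) / q%:R ^+ 2 - `|alpha - p%:~R / q%:R|.
  rewrite PQ /b; case: ltP => [lt|le]; rewrite /= ?expr1 ?expr0.
    rewrite (ltr0_norm (_ : alpha - p%:~R / q%:R < 0)) in pq *; last by lra.
    by rewrite ger0_norm; lra.
  rewrite (ger0_norm (_ : 0 <= alpha - p%:~R / q%:R)) in pq *; last by lra.
  by rewrite ler0_norm; lra.
have dist0 : 0 < `|alpha - P%:~R / Q%:R| by rewrite distE; lra.
have distB : `|alpha - P%:~R / Q%:R| <=
    (1 - eps) * (ratr (f (gf_arg f q)) / Q%:R ^+ 2).
  have -> : ratr (f (gf_arg f q)) / Q%:R ^+ 2 = ratr (gf f q) / q%:R ^+ 2 :> R.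
    have /(congr1 (@ratr R)) := gf_div_sqr f q fq0 q0.
    by rewrite -/Q !fmorph_div !rmorphXn /= !ratr_nat.
  rewrite distE mulrA lerBlDr -lerBlDl -mulrBl ler_pdivrMr //.
have fa0 : 0 < ratr (f (gf_arg f q)) :> R.
  by rewrite ltr0q; have /andP[] : 0 < f (gf_arg f q) <= 1
    by apply: f_range; rewrite /gf_arg addn2.
have Q2 : 0 < Q%:R ^+ 2 :> R by rewrite exprn_gt0 // ltr0n.
(* A positive distance is bounded by [1 - eps] times a positive number, so the case [eps >= 1] is
   already excluded. *)
have eps1 : 0 < 1 - eps.
  have := lt_le_trans dist0 distB; rewrite pmulr_lgt0 // divr_gt0 //.
have faQ : ratr (f (gf_arg f q)) <= ratr (f Q) :> R.
  by rewrite ler_rat f_decr // /gf_arg -/Q leq_addr.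
have fQ0 : 0 < ratr (f Q) :> R by apply: lt_le_trans faQ.
(* With [t = 1/Q^2 < eps], the claim reduces to [(1 - eps)(1 + t) f(Q) < f(Q)], which follows from
   [(1 - eps)(1 + eps) < 1]. *)
have strong : (1 - eps) * (ratr (f (gf_arg f q)) / Q%:R ^+ 2) <
    (ratr (f Q) - (1 - eps) * ratr (gf f Q)) / Q%:R ^+ 2.
  rewrite mulrA ltr_pM2r ?invr_gt0 //.
  have /andP[_] := gf_le f Q f_range Q0.
  rewrite -(ler_rat R) [leRHS]fmorph_div rmorphXn /= ratr_nat => gQ.
  have tE : (Q%:R ^+ 2)^-1 < eps :> R.
    rewrite -[eps]invrK ltf_pV2 ?posrE ?invr_gt0 //.
    by apply: lt_le_trans epsQ _; rewrite expr2 ler_peMl.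
  have t0 : 0 < (Q%:R ^+ 2)^-1 :> R by rewrite invr_gt0.
  set t := (Q%:R ^+ 2)^-1 in gQ tE t0.
  rewrite ltrBrDr -mulrDr.
  apply: (@le_lt_trans _ _ ((1 - eps) * (ratr (f Q) * (1 + t)))).
    by rewrite ler_pM2l // mulrDr mulr1 lerD.
  rewrite mulrCA gtr_pMr //.
  by nra.
have PS : `|alpha - P%:~R / Q%:R| <
    (ratr (f Q) - (1 - eps) * ratr (gf f Q)) / Q%:R ^+ 2.
  exact: le_lt_trans strong.
have ratrPQ : ratr (P%:~R / Q%:R) = P%:~R / Q%:R :> R.
  by rewrite fmorph_div /= ratr_int ratr_nat.
(* [P/Q] is in the solution set assumed finite and closer to [alpha] than [1/Q], so [far] forces
   equality, against [dist0]. *)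
have eqPQ : ratr (P%:~R / Q%:R) = alpha.
  apply: (far Q) => //; first exact: leq_trans qQ.
    by exists P, Q.
  rewrite ratrPQ; apply: le_lt_trans distB _.
  have fa1 := le_trans faQ (f_le1 _ Q0).
  rewrite mulrA ltr_pdivrMr // expr2 mulKf ?gt_eqF ?ltr0n //.
  by nra.
by move: dist0; rewrite -ratrPQ eqPQ subrr normr0 ltxx.
Qed.
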